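(* Let $m\ge 3$ be an integer and $e=(3^h-1)/2$, where $2\le h\le m-1$. The ternary cyclic code $\mathcal{C}_{(1,e)}$ has parameters $[3^m-1,\,3^m-1-2m,\,4]$ if and only if (a) $m$ is odd; (b) $h$ is even; (c) $\gcd(h,m)=1$; and (d) $\gcd(h-1,m)=1$.
   Context: Let $q=3^m$, $n=q-1$, $\alpha$ a generator of $\mathrm{GF}(q)^*$, and $m_a(x)$ the minimal polynomial of $a\in\mathrm{GF}(q)$ over $\mathrm{GF}(3)$. $C_j$ denotes the $3$-cyclotomic coset modulo $n$ containing $j$, i.e. $\{j,3j,3^2j,\dots\}$ mod $n$. For $1<e<q-1$ with $e\notin C_1$, $\mathcal{C}_{(1,e)}$ is the cyclic code of length $n$ over $\mathrm{GF}(3)$ with generator polynomial $m_\alpha(x)m_{\alpha^e}(x)$. *)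

(* Defs.v *)
From HB Require Import structures.
From mathcomp Require Import all_boot all_order all_algebra.
Set Implicit Arguments. Unset Strict Implicit. Unset Printing Implicit Defensive.
Import GRing.Theory.
Local Open Scope ring_scope.

Definition F3_to (F : finFieldType) (c : 'F_3) : F := (nat_of_ord c)%:R.

Definition is_minpoly (F : finFieldType) (a : F) (p : {poly 'F_3}) : Prop :=
  [/\ p \is monic, root (map_poly (@F3_to F) p) a &
      forall q : {poly 'F_3}, q != 0 -> root (map_poly (@F3_to F) q) a ->
        (size p <= size q)%N].

Definition word_poly (n : nat) (c : 'rV['F_3]_n) : {poly 'F_3} :=
  \sum_(i < n) c ord0 i *: 'X^i.

Definition cyclic_code (n : nat) (g : {poly 'F_3}) : {set 'rV['F_3]_n} :=
  [set c | g %| word_poly c].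

Definition wt (n : nat) (c : 'rV['F_3]_n) : nat := #|[set i | c ord0 i != 0]|.

Definition has_params (n : nat) (C : {set 'rV['F_3]_n}) (k d : nat) : Prop :=
  [/\ \dim (span (enum C)) = k,
      (exists2 c, c \in C & (c != 0) && (wt c == d)) &
      (forall c, c \in C -> c != 0 -> (d <= wt c)%N)].

Definition notin_C1 (n j : nat) : Prop := forall i : nat, (j %% n <> 3 ^ i %% n)%N.

(* Main.v *)
Require Import Defs.
From HB Require Import structures.
From mathcomp Require Import all_boot all_order all_algebra.
From mathcomp Require Import finfield zify ring.
Set Implicit Arguments. Unset Strict Implicit. Unset Printing Implicit Defensive.
Import GRing.Theory.
Local Open Scope ring_scope.

(** Since e = (3^h - 1)/2, one has x^(2e) = x^(3^h - 1), so the second parity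
    check of the code interacts with the Frobenius map x -> x^(3^h). For a
    codeword of weight three this forces two positions x, y to satisfy
    x^(2e) = y^(2e) or (x/y)^(e-1) = 1; if h and h - 1 are prime to m, either
    one gives x^2 = y^2, for any two of the positions, which is impossible. A
    word of weight four then exists because there are more words of weight two
    than syndromes. Conversely, if h is odd then {1, -1} supports a codeword, and
    a common divisor d > 1 of m and of h or h - 1 gives a codeword of weight
    three supported, up to signs, at t, t + 1, t - 1 for t in GF(3^d) outside
    GF(3). *)

(** * Powers of the Frobenius map in characteristic 3 *)

Lemma expr3nD (R : comNzRingType) (x y : R) (d : nat) : 3 \in [pchar R] ->
  (x + y) ^+ (3 ^ d) = x ^+ (3 ^ d) + y ^+ (3 ^ d).
Proof.
move=> ch; elim: d => [|d IHd] //.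
by rewrite expnSr !exprM IHd -!(pFrobenius_autE ch) rmorphD.
Qed.

Lemma expr3_inj (F : fieldType) : 3 \in [pchar F] -> injective (fun x : F => x ^+ 3).
Proof. by move=> ch x y /= /(fmorph_inj (pFrobenius_aut ch)). Qed.

Lemma expr3n_inj (F : fieldType) (d : nat) : 3 \in [pchar F] ->
  injective (fun x : F => x ^+ (3 ^ d)).
Proof.
move=> ch; elim: d => [|d IHd] x y //=.
by rewrite expnSr !exprM => /(expr3_inj ch) /IHd.
Qed.

Lemma expr3nM_fix (R : pzSemiRingType) (x : R) (d k : nat) :
  x ^+ (3 ^ d) = x -> x ^+ (3 ^ (d * k)) = x.
Proof.
by move=> fx; elim: k => [|k IHk]; rewrite ?muln0 // mulnS expnD exprM fx.
Qed.

(** The fixed points of the two Frobenius powers meet in GF(3): a Bezout relation between [d] and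
    [m] yields [x ^+ 3 = x]. *)
Lemma coprime_frob_sqr1 (F : fieldType) (x : F) (d m : nat) :
  (0 < d)%N -> coprime d m -> x != 0 ->
  x ^+ (3 ^ d) = x -> x ^+ (3 ^ m) = x -> x ^+ 2 = 1.
Proof.
move=> d_gt0 co x_neq0 fd fm.
have [[u v] /= uv] : exists u : nat * nat, (u.1 * d - u.2 * m = 1)%N.
  exact/coprimeP.
have e1 : (d * u = m * v + 1)%N by lia.
have := expr3nM_fix u fd.
rewrite e1 expnD exprM (expr3nM_fix v fm) expn1 exprS => xx.
by apply: (mulfI x_neq0); rewrite xx mulr1.
Qed.

Lemma expf_pred (F : fieldType) (x : F) (k : nat) :
  (0 < k)%N -> x != 0 -> (x ^+ (k - 1) == 1) = (x ^+ k == x).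
Proof.
move=> k_gt0 x_neq0; by rewrite -{2}(subnK k_gt0) addn1 exprS -(inj_eq (mulfI x_neq0)) mulr1.
Qed.

(** * Minimal polynomials over GF(3) *)

(** Bundling [F3_to] as a ring morphism makes the theory of [map_poly] applicable to it. *)
Lemma F3_exists_rmorph (F : finFieldType) : 3 \in [pchar F] ->
  exists f : {rmorphism 'F_3 -> F}, f =1 @F3_to F.
Proof.
move=> ch.
have addE : zmod_morphism (@F3_to F).
  move=> a b; apply: (addIr (@F3_to F b)); rewrite subrK -[in RHS](subrK b a).
  by rewrite /F3_to -natrD -(GRing.natr_mod_pchar ch (_ + _)).
have mulE : monoid_morphism (@F3_to F).
  by split=> // a b; rewrite /F3_to -natrM -(GRing.natr_mod_pchar ch (_ * _)).
pose f : {rmorphism 'F_3 -> F} :=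
  HB.pack (@F3_to F) (GRing.isZmodMorphism.Build _ _ _ addE)
    (GRing.isMonoidMorphism.Build _ _ _ mulE).
by exists f.
Qed.

Lemma F3_rmorph_pchar (F : fieldType) (f : {rmorphism 'F_3 -> F}) : 3 \in [pchar F].
Proof. exact/(rmorph_pchar f)/pchar_Fp. Qed.

Lemma F3_sqr1 (a : 'F_3) : a != 0 -> a ^+ 2 = 1.
Proof. by case: a => [[|[|[|]]]] //= ? _; apply/val_inj. Qed.

Lemma root_map_F3_expr (F : fieldType) (f : {rmorphism 'F_3 -> F})
    (p : {poly 'F_3}) (x : F) (i : nat) :
  root (map_poly f p) x -> root (map_poly f p) (x ^+ (3 ^ i)).
Proof.
have ch := F3_rmorph_pchar f.
move=> px; elim: i => [|i] //; rewrite expnSr exprM.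
move: (x ^+ _) => y /rootP py; apply/rootP.
(* Coefficients from GF(3) are fixed by Frobenius, so cubing commutes with evaluation. *)
have <- : map_poly (pFrobenius_aut ch) (map_poly f p) = map_poly f p.
  rewrite -map_poly_comp; apply: eq_map_poly => a /=.
  by rewrite -[a]natr_Zp rmorph_nat pFrobenius_aut_nat.
by rewrite -(pFrobenius_autE ch) horner_map py rmorph0.
Qed.

(** Pigeonhole: the 3^(m+1) polynomials of size at most m+1 take only 3^m values at [x], and the
    difference of two that collide vanishes there. *)
Lemma F3_annihilator (m : nat) (F : finFieldType) (f : {rmorphism 'F_3 -> F}) (x : F) :
  #|F| = (3 ^ m)%N ->
  exists2 q : {poly 'F_3}, q != 0 & (size q <= m.+1)%N && root (map_poly f q) x.
Proof.
move=> cF.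
pose ev (v : 'rV['F_3]_m.+1) := (map_poly f (rVpoly v)).[x].
have /injectivePn[u [v uv evE]] : ~~ injectiveb ev.
  apply/negP => /injectiveP /leq_card.
  by rewrite cF card_mx card_Fp // mul1n leq_exp2l // ltnn.
exists (rVpoly u - rVpoly v).
  by rewrite subr_eq0 (inj_eq (can_inj rVpolyK)).
rewrite -raddfB size_poly /= rootE !raddfB /= hornerD hornerN subr_eq0.
exact/eqP.
Qed.

(** The [m] distinct conjugates of [x] are roots, and [F3_annihilator] bounds the degree by [m]; a
    further root would exceed that bound. *)
Lemma minpoly_conjugates (m : nat) (F : finFieldType) (f : {rmorphism 'F_3 -> F})
    (x : F) (p : {poly 'F_3}) :
  #|F| = (3 ^ m)%N ->
  (forall i, (0 < i < m)%N -> x ^+ (3 ^ i) != x) ->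
  p != 0 -> root (map_poly f p) x ->
  (forall q : {poly 'F_3}, q != 0 -> root (map_poly f q) x -> (size p <= size q)%N) ->
  size p = m.+1 /\
  (forall y, root (map_poly f p) y -> exists i, y = x ^+ (3 ^ i)).
Proof.
move=> cF xi p0 px pmin.
have ch := F3_rmorph_pchar f.
have szp : (size p <= m.+1)%N.
  by have [q q0 /andP[szq qx]] := F3_annihilator f x cF; apply: leq_trans (pmin q q0 qx) _.
pose rs := mkseq (fun i => x ^+ (3 ^ i)) m.
have rsu : uniq rs.
  apply/(mkseq_uniqP _ m) => i j.
  suff wl a b : (a < b)%N -> b \in gtn m -> x ^+ (3 ^ a) <> x ^+ (3 ^ b).
    by move=> im jm eqij; case: (ltngtP i j) => // lt; [case: (wl i j) | case: (wl j i)].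
  move=> ab bm; rewrite -(subnK (ltnW ab)) expnD exprM => /(expr3n_inj ch)/esym/eqP.
  apply/negP/xi; move: bm; rewrite inE; lia.
have p0' : map_poly f p != 0 by rewrite map_poly_eq0.
have rsr : all (root (map_poly f p)) rs.
  by apply/allP => y /mapP[i _ ->]; apply: root_map_F3_expr.
have := max_poly_roots p0' rsr rsu; rewrite size_mkseq size_map_poly => szm.
split; first by apply/eqP; rewrite eqn_leq szp szm.
move=> y py; have [/mapP[i _ ->]|yrs] := boolP (y \in rs); first by exists i.
have := @max_poly_roots _ _ (y :: rs) p0'; rewrite /= py rsr yrs rsu size_mkseq size_map_poly.
by move=> /(_ isT isT); rewrite ltnNge szp.
Qed.

(** Split [p] as a cofactor times [gcdp p q]. If [x] is a root of the cofactor, minimality makes the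
    gcd constant; otherwise [x] is a root of the gcd, hence of [q]. *)
Lemma minpoly_coprimep (K F : fieldType) (f : {rmorphism K -> F}) (x : F)
    (p q : {poly K}) :
  p != 0 -> root (map_poly f p) x ->
  (forall r : {poly K}, r != 0 -> root (map_poly f r) x -> (size p <= size r)%N) ->
  ~~ root (map_poly f q) x -> coprimep p q.
Proof.
move=> p0 px pmin qx; have gp := dvdp_gcdl p q.
have := divpK gp; set r := (p %/ _) => pE.
have /orP[rx|gx] : root (map_poly f r) x || root (map_poly f (gcdp p q)) x.
  by rewrite -rootM -rmorphM pE.
  have r0 : r != 0 by apply: contraNneq p0 => r0; rewrite -pE r0 mul0r.
  have g0 : gcdp p q != 0 by apply: contraNneq p0 => g0; rewrite -pE g0 mulr0.
  have : (size (r * gcdp p q)%R <= size r)%N by rewrite pE; exact: pmin.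
  rewrite size_mul // coprimep_def eqn_leq size_poly_gt0 g0 andbT.
  by rewrite -subn1 leq_subLR addnC leq_add2r.
by case/negP: qx; move: (dvdp_gcdr p q); rewrite -(dvdp_map f) => /root_dvdp/(_ gx).
Qed.

(** * The exponent e = (3^h - 1)/2 and the equations of a word of weight three *)

Lemma half_pred3n (h : nat) : (3 ^ h = 2 * ((3 ^ h - 1) %/ 2) + 1)%N.
Proof.
have odd3h : odd (3 ^ h) by rewrite oddX orbT.
have : (0 < 3 ^ h)%N by rewrite expn_gt0.
lia.
Qed.

(** Passing from [h] to [h.+1] turns e into 3e + 1, which flips its parity. *)
Lemma odd_half_pred3n (h : nat) : odd ((3 ^ h - 1) %/ 2) = odd h.
Proof.
elim: h => // h IHh; rewrite /= -IHh.
have := half_pred3n h; have := half_pred3n h.+1; rewrite expnS; lia.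
Qed.

Lemma expf_eq1_odd (F : fieldType) (x : F) (e : nat) : ~~ odd e -> x ^+ 2 = 1 -> x ^+ e = 1.
Proof. by move=> /even_halfK <- x2; rewrite -muln2 mulnC exprM x2 expr1n. Qed.

(* With p = ax, q = by, r = cz and A = ax^e, B = by^e, C = cz^e, one has
   p^(3^h) = p A^2, so p + q + r = 0 gives p A^2 + q B^2 + r C^2 = 0.
   Eliminating r and C by A + B + C = 0 leaves (B - A)(p B - q A) = 0. *)
Lemma three_term_sqr_eq (F : finFieldType) (m h : nat) (x y z a b c : F) :
  #|F| = (3 ^ m)%N -> (1 < h)%N -> coprime h m -> coprime (h - 1) m ->
  a ^+ 2 = 1 -> b ^+ 2 = 1 -> c ^+ 2 = 1 -> x != 0 -> y != 0 ->
  a * x + b * y + c * z = 0 ->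
  a * x ^+ ((3 ^ h - 1) %/ 2) + b * y ^+ ((3 ^ h - 1) %/ 2)
    + c * z ^+ ((3 ^ h - 1) %/ 2) = 0 ->
  x ^+ 2 = y ^+ 2.
Proof.
move=> cF h1 coh coh1 a2 b2 c2 x0 y0; have ch := card_finPcharP cF (isT : prime 3).
have := half_pred3n h; move: (_ %/ _)%N => e Qe.
have powQ (d w : F) : d ^+ 2 = 1 -> (d * w) ^+ (3 ^ h) = (d * w) * (d * w ^+ e) ^+ 2.
  by move=> d2; rewrite Qe addn1 exprS exprM !(exprMn 2) d2 !mul1r -!exprM mulnC.
have t0 : x / y != 0 by rewrite mulf_neq0 ?invr_eq0.
have conclude d : (0 < d)%N -> coprime d m -> (x / y) ^+ (3 ^ d) = x / y -> x ^+ 2 = y ^+ 2.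
  move=> d0 co fixd; have fixm : (x / y) ^+ (3 ^ m) = x / y by rewrite -cF expf_card.
  have := coprime_frob_sqr1 d0 co t0 fixd fixm.
  by rewrite expr_div_n => /divr1_eq.
move=> s1 s2.
have s3 : (a * x) * (a * x ^+ e) ^+ 2 + (b * y) * (b * y ^+ e) ^+ 2
    + (c * z) * (c * z ^+ e) ^+ 2 = 0.
  by rewrite -!powQ // -!expr3nD // s1 expr0n expn_eq0.
have c3 : 3%:R = 0 :> F by exact: pcharf0 ch.
have : (b * y ^+ e - a * x ^+ e) * (a * x * (b * y ^+ e) - b * y * (a * x ^+ e)) = 0.
  move: s1 s2 s3; move: (a * x) (b * y) (c * z) (a * x ^+ e) (b * y ^+ e) (c * z ^+ e).
  move=> p q r A B C /eqP; rewrite addrC addr_eq0 => /eqP -> /eqP.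
  rewrite addrC addr_eq0 => /eqP -> s3.
  (* The factorisation holds only modulo 3; over the integers the two sides differ by this multiple
     of 3. *)
  transitivity (- (3%:R * (A * B * (p + q)))
    - (p * A ^+ 2 + q * B ^+ 2 + (- (p + q)) * (- (A + B)) ^+ 2)).
    by ring.
  by rewrite s3 c3; ring.
have a0 : a != 0 by rewrite -sqrf_eq0 a2 oner_eq0.
have b0 : b != 0 by rewrite -sqrf_eq0 b2 oner_eq0.
move/eqP; rewrite mulf_eq0 !subr_eq0 => /orP[/eqP AB|/eqP pB].
  apply: (conclude h) => //; first exact: ltnW.
  rewrite Qe addn1 exprS mulnC exprM.
  suff -> : ((x / y) ^+ e) ^+ 2 = 1 by rewrite mulr1.
  rewrite !expr_div_n; apply/eqP; rewrite -subr_eq0; apply/eqP.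
  have := congr1 (fun w => w ^+ 2) AB; rewrite !(exprMn 2) a2 b2 !mul1r => <-.
  by rewrite divff ?subrr // !expf_neq0.
apply: (conclude (h - 1)%N) => //; first by rewrite subn_gt0.
(* In this case (x/y)^e = x/y, so (x/y)^(3^h) = (x/y)^3, and a cube root can be taken on both
   sides. *)
apply: (expr3_inj ch) => /=; rewrite -exprM -expnSr subn1 prednK ?(ltnW h1) //.
rewrite Qe addn1 exprS mulnC exprM [RHS]exprS; congr (_ * _ ^+ 2).
have {pB} : x * y ^+ e = y * x ^+ e.
  apply: (mulfI (mulf_neq0 a0 b0)); rewrite mulrACA pB; ring.
move=> pB; rewrite expr_div_n; apply/eqP.
by rewrite eqr_div ?expf_neq0 // mulrC -pB mulrC.
Qed.

(** * Syndromes and words of small weight *)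

Definition synd (F : fieldType) (f : {rmorphism 'F_3 -> F}) (n : nat)
  (c : 'rV['F_3]_n) (x : F) : F := \sum_(i < n) f (c ord0 i) * x ^+ i.

Lemma synd_horner (F : fieldType) (f : {rmorphism 'F_3 -> F}) (n : nat)
  (c : 'rV['F_3]_n) (x : F) : (map_poly f (word_poly c)).[x] = synd f c x.
Proof.
rewrite /word_poly rmorph_sum horner_sum; apply: eq_bigr => i _.
by rewrite /= map_polyZ map_polyXn hornerZ hornerXn.
Qed.

Lemma syndD (F : fieldType) (f : {rmorphism 'F_3 -> F}) (n : nat)
  (c d : 'rV['F_3]_n) (x : F) : synd f (c + d) x = synd f c x + synd f d x.
Proof. by rewrite -big_split; apply: eq_bigr => i _; rewrite mxE rmorphD mulrDl. Qed.

Lemma syndB (F : fieldType) (f : {rmorphism 'F_3 -> F}) (n : nat)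
  (c d : 'rV['F_3]_n) (x : F) : synd f (c - d) x = synd f c x - synd f d x.
Proof. by rewrite -sumrB; apply: eq_bigr => i _; rewrite !mxE rmorphB mulrBl. Qed.

Lemma synd_delta (F : fieldType) (f : {rmorphism 'F_3 -> F}) (n : nat)
  (a : 'F_3) (i : 'I_n) (x : F) : synd f (a *: delta_mx ord0 i) x = f a * x ^+ i.
Proof.
rewrite /synd (bigD1 i) //= big1 ?addr0 => [|j ji]; first by rewrite !mxE !eqxx mulr1.
by rewrite !mxE (negPf ji) andbF mulr0 rmorph0 mul0r.
Qed.

Lemma wtD (n : nat) (c d : 'rV['F_3]_n) : (wt (c + d) <= wt c + wt d)%N.
Proof.
apply: leq_trans (leq_card_setU _ _); apply/subset_leq_card/subsetP => i.
rewrite !inE mxE; apply: contraR; rewrite negb_or !negbK => /andP[/eqP-> /eqP->].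
by rewrite addr0.
Qed.

Lemma wtN (n : nat) (c : 'rV['F_3]_n) : wt (- c) = wt c.
Proof. by apply: eq_card => i; rewrite !inE mxE oppr_eq0. Qed.

Lemma wt_delta (n : nat) (a : 'F_3) (i : 'I_n) : (wt (a *: delta_mx ord0 i) <= 1)%N.
Proof.
rewrite -[leqRHS](cards1 i); apply/subset_leq_card/subsetP => j; rewrite !inE !mxE /=.
by apply: contraR => /negPf->; rewrite mulr0.
Qed.

Lemma prim_expr_inj (F : fieldType) (n : nat) (alpha : F) :
  n.-primitive_root alpha -> injective (fun i : 'I_n => alpha ^+ i).
Proof.
move=> pr i j /= /eqP; rewrite (eq_prim_root_expr pr) !modn_small //.
by move/eqP/val_inj.
Qed.

(** Listing the support allows words of weight at most three to be treated by cases on the list. *)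
Lemma synd_supp (F : fieldType) (f : {rmorphism 'F_3 -> F}) (n : nat)
    (c : 'rV['F_3]_n) (x : F) :
  synd f c x = \sum_(i <- enum [set i | c ord0 i != 0]) f (c ord0 i) * x ^+ i.
Proof.
rewrite big_enum /= [RHS]big_mkcond; apply: eq_bigr => i _; rewrite inE.
by case: eqP => // ->; rewrite rmorph0 mul0r.
Qed.

(** The first equation forces x = -y; since [e] is even, the second then gives a = -b, and the first
    becomes 2by = 0. *)
Lemma two_term_absurd (F : fieldType) (e : nat) (x y a b : F) :
  2%:R != 0 :> F -> ~~ odd e -> a ^+ 2 = 1 -> b ^+ 2 = 1 -> y != 0 -> x != y ->
  a * x + b * y = 0 -> a * x ^+ e + b * y ^+ e = 0 -> False.
Proof.
move=> two0 ev a2 b2 y0 xy s1 s2.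
have a0 : a != 0 by rewrite -sqrf_eq0 a2 oner_eq0.
have xNy : x = - y.
  have /eqP : x ^+ 2 = y ^+ 2.
    rewrite -[LHS]mul1r -[RHS]mul1r -{1}a2 -b2 -!exprMn.
    by rewrite (eqP (_ : a * x == - (b * y))) ?sqrrN // -addr_eq0 s1.
  by rewrite eqf_sqr (negPf xy) => /eqP.
move: s2; rewrite xNy exprNn -signr_odd (negPf ev) mul1r -mulrDl => /eqP.
rewrite mulf_eq0 expf_eq0 (negPf y0) andbF orbF addr_eq0 => /eqP aNb.
move/eqP: s1; rewrite xNy aNb mulrNN -mulr2n -mulr_natl mulf_eq0 (negPf two0) /=.
by rewrite mulf_eq0 (negPf y0) orbF -oppr_eq0 -aNb (negPf a0).
Qed.

Lemma min_dist_ge4 (m h : nat) (F : finFieldType) (f : {rmorphism 'F_3 -> F})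
    (alpha : F) (c : 'rV['F_3]_(3 ^ m - 1)) :
  #|F| = (3 ^ m)%N -> (3 ^ m - 1)%N.-primitive_root alpha ->
  (1 < h)%N -> ~~ odd h -> coprime h m -> coprime (h - 1) m ->
  synd f c alpha = 0 -> synd f c (alpha ^+ ((3 ^ h - 1) %/ 2)) = 0 -> c != 0 ->
  (4 <= wt c)%N.
Proof.
move=> cF pr h1 hev coh coh1 + + c0; have ch := card_finPcharP cF (isT : prime 3).
have ev := hev; rewrite -odd_half_pred3n in ev.
have two0 : 2%:R != 0 :> F by rewrite -(dvdn_pcharf ch).
have al0 i : alpha ^+ i != 0 by rewrite expf_neq0 // (prim_root_eq0 pr) -lt0n (prim_order_gt0 pr).
have fc2 i : c ord0 i != 0 -> f (c ord0 i) ^+ 2 = 1.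
  by move=> /F3_sqr1 E; rewrite -rmorphXn E rmorph1.
have inj := prim_expr_inj pr.
rewrite !synd_supp /wt cardE.
have := enum_uniq [set i | c ord0 i != 0].
have : forall i, i \in enum [set i | c ord0 i != 0] -> c ord0 i != 0.
  by move=> i; rewrite mem_enum inE.
have : enum [set i | c ord0 i != 0] != [::].
  have /rV0Pn[i ci] := c0.
  by apply/eqP => en; have : i \in [::] by rewrite -en mem_enum inE.
case: (enum _) => [//|i [|j [|k [|l s]]]] //= _ cS; rewrite ?inE ?andbT.
- move=> _; rewrite big_seq1 => /eqP; rewrite mulf_eq0 (negPf (al0 i)) orbF.
  by rewrite fmorph_eq0 (negPf (cS _ _)) // inE.
- move=> ij; rewrite !big_cons !big_nil !addr0 -!exprM ![(_ %/ _ * _)%N]mulnC !exprM.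
  by move=> s1 s2; case: (two_term_absurd two0 ev _ _ _ _ s1 s2);
    rewrite ?fc2 ?cS ?inE ?eqxx ?orbT // (inj_eq inj).
rewrite negb_or => /andP[/andP[ij ik] jk].
rewrite !big_cons !big_nil !addr0 -!exprM ![(_ %/ _ * _)%N]mulnC !exprM !addrA.
move=> s1 s2.
have [ci [cj ck]] : f (c ord0 i) ^+ 2 = 1 /\ f (c ord0 j) ^+ 2 = 1 /\ f (c ord0 k) ^+ 2 = 1.
  by rewrite !fc2 ?cS ?inE ?eqxx ?orbT.
have /eqP := three_term_sqr_eq cF h1 coh coh1 ci cj ck (al0 i) (al0 j) s1 s2.
rewrite eqf_sqr (inj_eq inj) (negPf ij) /= => /eqP ai.
(* Two pairs suffice: positions [i] and [k] both carry the opposite of the element at [j], hence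
   coincide. *)
have /eqP : (alpha ^+ k) ^+ 2 = (alpha ^+ j) ^+ 2.
  apply: (three_term_sqr_eq (z := alpha ^+ i) cF h1 coh coh1 ck cj ci (al0 k) (al0 j)).
    by rewrite -[RHS]s1; ring.
  by rewrite -[RHS]s2; ring.
rewrite eqf_sqr (inj_eq inj) eq_sym (negPf jk) /= -ai (inj_eq inj) eq_sym.
by rewrite (negPf ik).
Qed.

(** Every nonzero field element is a power of [alpha], hence a position. The points [y] and [z] may
    coincide and [b], [d] may vanish, since the coordinate at [x] already makes the word nonzero. *)
Lemma light_word (m h : nat) (F : finFieldType) (f : {rmorphism 'F_3 -> F})
    (alpha x y z : F) (a b d : 'F_3) (e : nat) :
  #|F| = (3 ^ m)%N -> (3 ^ m - 1)%N.-primitive_root alpha ->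
  x != 0 -> y != 0 -> z != 0 -> x != y -> x != z -> a != 0 ->
  f a * x + f b * y + f d * z = 0 ->
  f a * x ^+ e + f b * y ^+ e + f d * z ^+ e = 0 ->
  exists c : 'rV['F_3]_(3 ^ m - 1),
    [/\ synd f c alpha = 0, synd f c (alpha ^+ e) = 0, c != 0 & (wt c <= 3)%N].
Proof.
move=> cF pr x0 y0 z0 xy xz a0 s1 s2.
have log w : w != 0 -> {i : 'I_(3 ^ m - 1) | w = alpha ^+ i}.
  move=> w0; apply: (prim_rootP pr); apply/eqP.
  by rewrite expf_pred ?expn_gt0 // -cF expf_card.
have [i xi] := log x x0; have [j yj] := log y y0; have [k zk] := log z z0.
exists (a *: delta_mx ord0 i + b *: delta_mx ord0 j + d *: delta_mx ord0 k); split.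
- by rewrite !syndD !synd_delta -xi -yj -zk.
- by rewrite !syndD !synd_delta -!exprM ![(e * _)%N]mulnC !exprM -xi -yj -zk.
- apply/rV0Pn; exists i; rewrite !mxE !eqxx /=.
  have -> : (i == j) = false by apply: contraNF xy => /eqP ij; rewrite xi yj ij.
  have -> : (i == k) = false by apply: contraNF xz => /eqP ik; rewrite xi zk ik.
  by rewrite !mulr0 !addr0 mulr1.
apply: (leq_trans (wtD _ _)); apply: (@leq_add _ _ 2 1 _ (wt_delta _ _)).
by apply: (leq_trans (wtD _ _)); apply: (@leq_add _ _ 1 1); apply: wt_delta.
Qed.

(** * Dimension of a cyclic code, and existence of a word of weight at most four *)

Lemma word_polyE (n : nat) (c : 'rV['F_3]_n) : word_poly c = rVpoly c.
Proof.
apply/polyP => k; rewrite coef_sum coef_rVpoly; under eq_bigr do rewrite coefZ coefXn.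
case: insubP => [i _ <-|kn].
  rewrite (bigD1 i) //= eqxx mulr1 big1 ?addr0 // => j /negPf ji.
  by rewrite eq_sym (inj_eq val_inj) ji mulr0.
rewrite big1 // => i _; case: eqP => [ki|_]; last by rewrite mulr0.
by rewrite ki ltn_ord in kn.
Qed.

(** Multiplication by [g] maps the polynomials of degree below n - deg g injectively onto the
    code. *)
Lemma dim_cyclic_code (n : nat) (g : {poly 'F_3}) : g != 0 -> (size g <= n.+1)%N ->
  \dim (span (enum (cyclic_code n g))) = (n - (size g).-1)%N.
Proof.
move=> g0 szg; set k := (n - _)%N; have g_gt0 : (0 < size g)%N by rewrite size_poly_gt0.
pose mulg (v : 'rV['F_3]_k) : 'rV['F_3]_n := poly_rV (rVpoly v * g).
have mulg_lin : linear mulg by move=> a u v; rewrite /mulg linearP mulrDl -scalerAl linearP.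
pose phi : 'Hom('rV['F_3]_k, 'rV['F_3]_n) :=
  linfun (HB.pack mulg (GRing.isLinear.Build _ _ _ _ mulg mulg_lin) : {linear _ -> _}).
have kE : (k + size g = n.+1)%N by rewrite /k; lia.
have sz_mulg (v : 'rV['F_3]_k) : (size (rVpoly v * g)%R <= n)%N.
  apply: leq_trans (size_polyMleq _ _) _; rewrite -subn1 leq_subLR add1n.
  by rewrite -kE leq_add2r; exact: size_poly.
have phiE v : phi v = mulg v by rewrite lfunE.
have phi_inj : lker phi == 0%VS.
  apply/lker0P => u v; rewrite !phiE => /(congr1 rVpoly).
  by rewrite !poly_rV_K // => /(mulIf g0) /(can_inj rVpolyK).
have <- : \dim (phi @: fullv) = k.
  by rewrite limg_dim_eq ?(eqP phi_inj) ?capv0 // dimvf /dim /= mul1n.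
congr (\dim _); apply/eqP; rewrite eqEsubv; apply/andP; split.
  apply/span_subvP => c; rewrite mem_enum inE word_polyE => /dvdpP[q cq].
  apply/memv_imgP; exists (poly_rV q); rewrite ?memvf // phiE /mulg.
  rewrite poly_rV_K -?cq ?rVpolyK //.
  have [->|q0] := eqVneq q 0; first by rewrite size_poly0.
  have : (size (rVpoly c) <= n)%N by exact: size_poly.
  by rewrite cq size_mul // -subn1 leq_subLR add1n -kE leq_add2r.
apply/subvP => c /memv_imgP[v _ ->]; apply: memv_span; rewrite mem_enum inE phiE.
by rewrite word_polyE poly_rV_K // dvdp_mull.
Qed.

(* Ordered pairs of positions, with a Boolean telling opposite coefficients
   from equal ones; in the latter case the common sign records the order. *)
Definition weight2_word (k : nat) (t : 'I_k.+1 * 'I_k * bool) : 'rV['F_3]_k.+1 :=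
  let: (i, j, s) := t in
  (-1) ^+ (~~ s && (lift i j < i)%N) *: delta_mx ord0 i
  + (-1) ^+ (s || (lift i j < i)%N) *: delta_mx ord0 (lift i j).

Lemma weight2_word_inj (k : nat) : injective (@weight2_word k).
Proof.
have wE i j s l : weight2_word (i, j, s) ord0 l =
    if l == i then (-1) ^+ (~~ s && (lift i j < i)%N)
    else if l == lift i j then (-1) ^+ (s || (lift i j < i)%N) else 0.
  rewrite !mxE /=; case: eqVneq => [->|_].
    by rewrite (negPf (neq_lift _ _)) mulr1 mulr0 addr0.
  by case: eqVneq; rewrite ?mulr1 !mulr0 add0r.
move=> [[i j] s] [[i' j'] s'] /rowP E.
have := E i; have := E (lift i j); rewrite !wE !eqxx ![lift i j == i]eq_sym (negPf (neq_lift _ _)).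
have [ii'|ii'] := eqVneq i i'.
  subst i'; rewrite eq_sym (negPf (neq_lift _ _)) (inj_eq (@lift_inj _ _)).
  have [<-|] := eqVneq j j'; last by case: (s || _).
  by case: s s' {E} => [] [] //=; case: (lift i j < i)%N => //.
have [ij'|] := eqVneq i (lift i' j'); last by case: (~~ s && _).
have [ji'|] := eqVneq (lift i j) i'.
  (* The supports agree with the positions exchanged: this negates both coefficients of an opposite
     pair, and reverses the order recorded by the sign of an equal pair. *)
  rewrite -ij' ji'; case: s s' {E} => [] [] //=;
  case: (ltngtP i i') => // /val_inj ei; by rewrite ei eqxx in ii'.
by rewrite -ij' [lift i j == i]eq_sym (negPf (neq_lift _ _)); case: (s || _).
Qed.

Lemma wt_weight2_word (k : nat) (t : 'I_k.+1 * 'I_k * bool) : (wt (weight2_word t) <= 2)%N.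
Proof.
by case: t => [[i j] s]; apply: (leq_trans (wtD _ _)); apply: (@leq_add _ _ 1 1); apply: wt_delta.
Qed.

(** Two distinct words of weight two share both syndromes by pigeonhole; their difference is the
    required word. *)
Lemma weight4_word (n : nat) (F : finFieldType) (f : {rmorphism 'F_3 -> F}) (x y : F) :
  (#|F| * #|F| < n * (n - 1) * 2)%N ->
  exists c : 'rV['F_3]_n, [/\ synd f c x = 0, synd f c y = 0, c != 0 & (wt c <= 4)%N].
Proof.
case: n => [|k]; rewrite ?subn1 //= => cFn.
pose sy t := (synd f (@weight2_word k t) x, synd f (weight2_word t) y).
have /injectivePn[t [u tu [s1 s2]]] : ~~ injectiveb sy.
  apply/negP => /injectiveP /leq_card.
  by rewrite !card_prod !card_ord card_bool leqNgt cFn.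
exists (weight2_word t - weight2_word u); split.
- by rewrite syndB s1 subrr.
- by rewrite syndB s2 subrr.
- by rewrite subr_eq0 (inj_eq (@weight2_word_inj _)).
by apply: (leq_trans (wtD _ _)); rewrite wtN; apply: (@leq_add _ _ 2 2); apply: wt_weight2_word.
Qed.

(** * Words of weight at most three from subfields *)

Lemma F3_sign (F : fieldType) (f : {rmorphism 'F_3 -> F}) (v w : F) :
  v ^+ 2 = w ^+ 2 -> exists2 s : 'F_3, s != 0 & f s * v = w.
Proof.
move/eqP; rewrite eqf_sqr => /orP[] /eqP->; first by exists 1; rewrite ?rmorph1 ?mul1r.
by exists (-1); rewrite // rmorphN1 mulN1r opprK.
Qed.

(* On the subfield GF(3^d) one has y^e = +-1 if d divides h, and y^e = +-y if d
   divides h - 1. Taking t outside GF(3), the signs of t, t + 1, t - 1 are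
   absorbed into the coefficients of a word of weight three. *)
Lemma subfield_light_word (m h d : nat) (F : finFieldType) (f : {rmorphism 'F_3 -> F})
    (alpha : F) :
  #|F| = (3 ^ m)%N -> (3 ^ m - 1)%N.-primitive_root alpha ->
  (0 < h)%N -> ~~ odd h -> (1 < d)%N -> (d %| m)%N -> (d %| h)%N || (d %| h - 1)%N ->
  exists c : 'rV['F_3]_(3 ^ m - 1),
    [/\ synd f c alpha = 0, synd f c (alpha ^+ ((3 ^ h - 1) %/ 2)) = 0,
        c != 0 & (wt c <= 3)%N].
Proof.
move=> cF pr h0 hev d1 dm dh; have ch := card_finPcharP cF (isT : prime 3).
have := half_pred3n h; have := odd_half_pred3n h; rewrite (negPf hev).
move: (_ %/ _)%N => e oe Qe.
have c3 : 3%:R = 0 :> F by exact: pcharf0 ch.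
(* A generator of the multiplicative group of GF(3^d); its order is at least 8, so it lies outside
   GF(3). *)
pose t := alpha ^+ ((3 ^ m - 1) %/ (3 ^ d - 1)).
have prt : (3 ^ d - 1)%N.-primitive_root t.
  apply: (dvdn_prim_root pr).
  by move/dvdnP: dm => [k ->]; rewrite mulnC expnM !subn1 dvdn_pred_predX.
have t0 : t != 0 by rewrite (prim_root_eq0 prt) -lt0n (prim_order_gt0 prt).
have t2 : t ^+ 2 != 1.
  rewrite -(prim_order_dvd prt); apply/negP => /dvdn_leq -/(_ isT).
  have : (3 ^ 2 <= 3 ^ d)%N by rewrite leq_exp2l.
  lia.
have fixt : t ^+ (3 ^ d) = t.
  by apply/eqP; rewrite -expf_pred ?expn_gt0 // (prim_expr_order prt).
move: t2; rewrite sqrf_eq1 negb_or => /andP[t1 tN1].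
(* Up to sign, y^e is [w y]: take the constant 1 if [d] divides [h], and the identity if [d] divides
   [h - 1]. The sums are then 3 and 3t, both zero. *)
have [w w_sum w_sqr] : exists2 w : F -> F, w t + w (t + 1) + w (t - 1) = 0 &
    forall y, y != 0 -> y ^+ (3 ^ d) = y -> (y ^+ e) ^+ 2 = w y ^+ 2.
  case/orP: dh => /dvdnP[k hk].
    exists (fun=> 1) => [|y y0 fixy]; first by rewrite -[RHS]c3; ring.
    have := expr3nM_fix k fixy; rewrite mulnC -hk Qe addn1 exprS mulnC exprM => E.
    by apply: (mulfI y0); rewrite E expr1n mulr1.
  exists id => [|y y0 fixy]; first by rewrite -[RHS](mul0r t) -c3; ring.
  have := expr3nM_fix k fixy; rewrite mulnC -hk => fixy'.
  have : y ^+ (3 ^ h) = y ^+ 3 by rewrite -(subnK h0) expnD exprM fixy'.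
  by rewrite Qe addn1 exprS [RHS]exprS mulnC exprM => /(mulfI y0).
have one_fix : (1 : F) ^+ (3 ^ d) = 1 by rewrite expr1n.
have N1_fix : (- 1 : F) ^+ (3 ^ d) = - 1 by rewrite -signr_odd oddX orbT expr1.
have tp0 : t + 1 != 0 by rewrite addr_eq0.
have tm0 : t - 1 != 0 by rewrite subr_eq0.
have [a a0 aE] := F3_sign f (w_sqr t t0 fixt).
have [b b0 bE] := F3_sign f (w_sqr (t + 1) tp0 ltac:(by rewrite expr3nD // fixt one_fix)).
have [g g0 gE] := F3_sign f (w_sqr (t - 1) tm0 ltac:(by rewrite expr3nD // fixt N1_fix)).
have f2 s : s != 0 -> f s ^+ 2 = 1 by move=> /F3_sqr1 E; rewrite -rmorphXn E rmorph1.
have fs0 s : s != 0 -> f s != 0 by rewrite fmorph_eq0.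
have fsK s y : s != 0 -> f s * (f s * y) = y by move=> /f2 E; rewrite mulrA -expr2 E mul1r.
have fse s y : s != 0 -> (f s * y) ^+ e = y ^+ e.
  by move=> /f2 E; rewrite exprMn (expf_eq1_odd _ E) ?mul1r // oe.
have sqr_neq s r y z : s != 0 -> r != 0 -> y ^+ 2 - z ^+ 2 != 0 -> f s * y != f r * z.
  move=> /f2 s2 /f2 r2; apply: contraNneq => /(congr1 (fun v => v ^+ 2)).
  by rewrite !(exprMn 2) s2 r2 !mul1r => ->; rewrite subrr.
(* Each sign enters both the point and its coefficient. The signs cancel in the first check; in the
   second, even [e] removes them from the points, and the coefficients turn each y^e into [w y]. *)
apply: (@light_word _ _ _ f alpha (f a * t) (f b * (t + 1)) (f g * (t - 1)) a b g e cF pr);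
  rewrite ?mulf_neq0 ?fs0 //.
(* Modulo 3, the squares of t and t + 1 differ by t - 1, and those of t and t - 1 by -(t + 1);
   neither vanishes. *)
- apply: sqr_neq => //.
  rewrite (_ : _ - _ = (t - 1) - 3%:R * t); last by ring.
  by rewrite c3 mul0r subr0.
- apply: sqr_neq => //.
  rewrite (_ : _ - _ = - (t + 1) + 3%:R * t); last by ring.
  by rewrite c3 mul0r addr0 oppr_eq0.
- by rewrite !fsK // -[RHS](mul0r t) -c3; ring.
by rewrite !fse // aE bE gE.
Qed.

(** * Degrees of the two minimal polynomials, and the equivalence *)

(** The remainder of [q] modulo [p] vanishes at [x] and is smaller than [p], so it is zero. *)
Lemma minpoly_dvdp (K F : fieldType) (f : {rmorphism K -> F}) (x : F) (p q : {poly K}) :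
  p != 0 -> root (map_poly f p) x ->
  (forall r : {poly K}, r != 0 -> root (map_poly f r) x -> (size p <= size r)%N) ->
  (p %| q) = root (map_poly f q) x.
Proof.
move=> p0 px pmin; apply/idP/idP => [|qx].
  by rewrite -(dvdp_map f) => /root_dvdp/(_ px).
apply/modp_eq0P; apply/eqP; apply: contraTT (ltn_modpN0 q p0) => r0.
rewrite -leqNgt pmin // rootE.
have := divp_eq q p; set s := (q %/ p); set r := (q %% p) => E.
move: qx; rewrite {1}E rmorphD rmorphM rootE hornerD hornerM (rootP px) mulr0 add0r.
by [].
Qed.

Lemma is_minpolyE (F : finFieldType) (f : {rmorphism 'F_3 -> F}) (a : F) (p : {poly 'F_3}) :
  f =1 @F3_to F -> is_minpoly a p ->
  [/\ p != 0, root (map_poly f p) a &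
    forall q : {poly 'F_3}, q != 0 -> root (map_poly f q) a -> (size p <= size q)%N].
Proof.
move=> fE [mp pa pmin]; split; first exact: monic_neq0.
  by rewrite (eq_map_poly fE).
by move=> q q0; rewrite (eq_map_poly fE); apply: pmin.
Qed.

Lemma prim_conjugates_neq (F : fieldType) (m i : nat) (alpha : F) :
  (3 ^ m - 1)%N.-primitive_root alpha -> (0 < i < m)%N -> alpha ^+ (3 ^ i) != alpha.
Proof.
move=> pr /andP[i0 im].
have al0 : alpha != 0 by rewrite (prim_root_eq0 pr) -lt0n (prim_order_gt0 pr).
rewrite -expf_pred ?expn_gt0 // -(prim_order_dvd pr).
have : (3 ^ 1 <= 3 ^ i)%N by rewrite leq_exp2l.
have : (3 ^ i < 3 ^ m)%N by rewrite ltn_exp2l.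
by move=> ? ?; apply/negP => /dvdn_leq; lia.
Qed.

(** Otherwise t = alpha^(3^i - 1) has t^e = 1, so t^(3^h) = t and t^2 = 1; but 2(3^i - 1) is
    positive and below the order of [alpha]. *)
Lemma exp_half_conjugates_neq (F : finFieldType) (m h i : nat) (alpha : F) :
  #|F| = (3 ^ m)%N -> (3 ^ m - 1)%N.-primitive_root alpha -> (0 < h)%N -> coprime h m ->
  (0 < i < m)%N ->
  (alpha ^+ ((3 ^ h - 1) %/ 2)) ^+ (3 ^ i) != alpha ^+ ((3 ^ h - 1) %/ 2).
Proof.
move=> cF pr h0 co /andP[i0 im].
have al0 : alpha != 0 by rewrite (prim_root_eq0 pr) -lt0n (prim_order_gt0 pr).
have := half_pred3n h; move: (_ %/ _)%N => e Qe.
rewrite -expf_pred ?expn_gt0 ?expf_neq0 // exprAC; apply/negP => /eqP te.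
set t := alpha ^+ _ in te; have t0 : t != 0 by rewrite expf_neq0.
have : t ^+ 2 = 1.
  apply: (coprime_frob_sqr1 h0 co t0); last by rewrite -cF expf_card.
  by rewrite Qe addn1 exprS mulnC exprM te expr1n mulr1.
rewrite -exprM => /eqP; rewrite -(prim_order_dvd pr) => /dvdn_leq.
have : (3 ^ 1 <= 3 ^ i)%N by rewrite leq_exp2l.
have : (3 ^ i.+1 <= 3 ^ m)%N by rewrite leq_exp2l.
rewrite expnS; lia.
Qed.

Theorem theorem6 (m h : nat) (F : finFieldType) (alpha : F)
    (g1 g2 : {poly 'F_3}) :
  (3 <= m)%N -> (2 <= h <= m - 1)%N ->
  #|F| = (3 ^ m)%N ->
  (3 ^ m - 1)%N.-primitive_root alpha ->
  notin_C1 (3 ^ m - 1) ((3 ^ h - 1) %/ 2) ->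
  is_minpoly alpha g1 ->
  is_minpoly (alpha ^+ ((3 ^ h - 1) %/ 2)) g2 ->
  (has_params (cyclic_code (3 ^ m - 1) (g1 * g2)) (3 ^ m - 1 - 2 * m) 4
   <-> [/\ odd m, ~~ odd h, coprime h m & coprime (h - 1) m]).
Proof.
move=> m3 /andP[h1 hm] cF pr enC; have ch := card_finPcharP cF (isT : prime 3).
have [f fE] := F3_exists_rmorph ch.
move=> /(is_minpolyE fE)[g10 g1r g1min] /(is_minpolyE fE)[g20 g2r g2min].
have [sz1 conj1] := minpoly_conjugates cF (fun i => prim_conjugates_neq (i := i) pr) g10 g1r g1min.
have h0 : (0 < h)%N by exact: ltnW.
have co12 : coprimep g2 g1.
  apply: (minpoly_coprimep g20 g2r g2min); apply/negP => /conj1[i] /eqP.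
  by rewrite (eq_prim_root_expr pr) => /eqP; apply: enC.
have memE c : (c \in cyclic_code (3 ^ m - 1) (g1 * g2)) =
    (synd f c alpha == 0) && (synd f c (alpha ^+ ((3 ^ h - 1) %/ 2)) == 0).
  rewrite inE Gauss_dvdp 1?coprimep_sym // (minpoly_dvdp _ g10 g1r g1min).
  by rewrite (minpoly_dvdp _ g20 g2r g2min) !rootE !synd_horner.
have pow27 : (27 <= 3 ^ m)%N by rewrite (@leq_exp2l 3 3 m).
split=> [[_ _ dmin]|[_ hev coh coh1]].
  have no_light : ~ exists c : 'rV['F_3]_(3 ^ m - 1),
      [/\ synd f c alpha = 0, synd f c (alpha ^+ ((3 ^ h - 1) %/ 2)) = 0,
        c != 0 & (wt c <= 3)%N].
    by move=> [c [s1 s2 c0]]; rewrite leqNgt dmin // memE s1 s2 !eqxx.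
  have hev : ~~ odd h.
    apply/negP => oh; apply: no_light.
    (* For odd [h] the exponent is odd, so equal coefficients at 1 and -1 satisfy both checks; the
       third term has coefficient zero. *)
    apply: (@light_word _ _ _ f alpha 1 (-1) (-1) 1 1 0 _ cF pr);
      rewrite ?oppr_eq0 ?oner_neq0 //.
    + by rewrite -addr_eq0 -(dvdn_pcharf ch 2).
    + by rewrite -addr_eq0 -(dvdn_pcharf ch 2).
    + by rewrite rmorph1 rmorph0; ring.
    by rewrite -signr_odd odd_half_pred3n oh expr1n rmorph1 rmorph0; ring.
  have sub k : (k == h) || (k == h - 1)%N -> coprime k m.
    move=> kh; rewrite /coprime; apply/negP => /negP gk; apply: no_light.
    apply: (@subfield_light_word _ _ (gcdn k m) _ _ _ cF pr h0 hev).
    + by have : (0 < gcdn k m)%N by [rewrite gcdn_gt0 orbC (leq_trans _ m3)]; lia.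
    + exact: dvdn_gcdr.
    by case/orP: kh => /eqP <-; rewrite dvdn_gcdl ?orbT.
  have coh : coprime h m by rewrite sub ?eqxx.
  split=> //; last by rewrite sub ?eqxx ?orbT.
  (* Oddness of [m] follows from [h] being even and prime to [m]. *)
  apply: contraT => mev; have : (2 %| gcdn h m)%N by rewrite dvdn_gcd !dvdn2 hev mev.
  by rewrite (eqP coh).
have [sz2 _] := minpoly_conjugates cF (fun i => exp_half_conjugates_neq cF pr h0 coh (i := i))
   g20 g2r g2min.
split.
- have sz : size (g1 * g2) = (2 * m).+1.
    by rewrite size_mul // sz1 sz2; lia.
  rewrite dim_cyclic_code ?sz ?mulf_neq0 //.
  (* This is the size bound for the generator, whose size is 2m + 1. *)
  have : (2 * m < 3 ^ m)%N by elim: (m) => // k; rewrite expnS; lia.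
  lia.
- have [|c [s1 s2 c0 c4]] := @weight4_word (3 ^ m - 1) F f alpha (alpha ^+ ((3 ^ h - 1) %/ 2)).
    (* With N = 3^m the count is N^2 < 2(N - 1)(N - 2), true for N at least 27. *)
    rewrite cF; move: (3 ^ m)%N pow27 => N; nia.
  exists c; first by rewrite memE s1 s2 eqxx.
  rewrite c0 eqn_leq c4 /=; exact: (min_dist_ge4 cF pr h1 hev coh coh1 s1 s2 c0).
move=> c; rewrite memE => /andP[/eqP s1 /eqP s2] c0.
exact: (min_dist_ge4 cF pr h1 hev coh coh1 s1 s2 c0).
Qed.
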